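(* Let $K$ be a field, $\mathcal{Q}$ a finite quiver, and $\Lambda=K\mathcal{Q}/I$, where $I$ is an ideal in $K\mathcal{Q}$ contained in the ideal generated by the paths of length 2 in $K\mathcal{Q}$. Suppose that $\mathcal{L}$ is a convex subquiver of $\mathcal{Q}$ and let $\Gamma=\Lambda/\langle e'_{\mathcal{L}}\rangle$ be the algebra associated to $(\mathcal{L},\Lambda)$. Then the canonical surjection $\Lambda\to\Gamma$ is a homological epimorphism.
   Context: All subquivers are full: a subquiver $\mathcal{L}$ of $\mathcal{Q}$ is full if for any two vertices $v,w$ of $\mathcal{L}$, all arrows of $\mathcal{Q}$ from $v$ to $w$ belong to $\mathcal{L}$. A full subquiver $\mathcal{L}$ is convex if for any two vertices $v,w$ in $\mathcal{L}$ and any (directed) path $p$ in $\mathcal{Q}$ from $v$ to $w$, every vertex occurring in $p$ is in $\mathcal{L}$. $K\mathcal{Q}$ is the path algebra; $ab$ denotes first $a$ then $b$. The idempotent $e'_{\mathcal{L}}$ is the sum of the vertices of $\mathcal{Q}$ not in $\mathcal{L}$ (viewed in $\Lambda$), and $\langle e'_{\mathcal{L}}\rangle$ is the two-sided ideal of $\Lambda$ it generates. Modules are right modules. A ring epimorphism $A\to B$ is a homological epimorphism if the induced functor $\mathcal{D}^b(\mathrm{mod}(B))\to\mathcal{D}^b(\mathrm{mod}(A))$ (restriction of scalars) on bounded derived categories is fully faithful; here $\mathrm{mod}(A)$ is the category of right $A$-modules. *)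

(* Defs.v *)
From HB Require Import structures.
From mathcomp Require Import all_boot all_order all_algebra.
From mathcomp Require Import generic_quotient ring_quotient.
From mathcomp Require Import finmap monalg.
From mathcomp Require Import boolp.

Set Implicit Arguments.
Unset Strict Implicit.
Unset Printing Implicit Defensive.

Import GRing.Theory.
Local Open Scope ring_scope.

(******************************************************************************)
(* Rings are unital and possibly zero (pzRingType), since the quiver or the   *)
(* subquiver may be empty.  A right module over A is an lmodType over A^c.    *)
(******************************************************************************)

Record quiver := Quiver {
  vertex : finType;
  arrow : finType;
  source : arrow -> vertex;
  target : arrow -> vertex
}.

Section Paths.
Variable Q : quiver.

Fixpoint walk (v : vertex Q) (s : seq (arrow Q)) : bool :=
  if s is a :: s' then (source a == v) && walk (target a) s' else true.

(* A directed path is its starting vertex together with its composable arrows, *)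
(* in the order in which they are travelled; (v, [::]) is the trivial path.    *)
Definition qpath := {p : vertex Q * seq (arrow Q) | walk p.1 p.2}.
HB.instance Definition _ := Choice.on qpath.

Definition path_source (p : qpath) : vertex Q := (val p).1.
Definition path_arrows (p : qpath) : seq (arrow Q) := (val p).2.
Definition path_vertices (p : qpath) : seq (vertex Q) :=
  path_source p :: map (@target Q) (path_arrows p).
Definition path_target (p : qpath) : vertex Q :=
  last (path_source p) (map (@target Q) (path_arrows p)).
Definition path_length (p : qpath) : nat := size (path_arrows p).

Definition trivial_path (v : vertex Q) : qpath :=
  exist (fun p : vertex Q * seq (arrow Q) => walk p.1 p.2) (v, [::]) isT.

Definition path_cat (p q : qpath) : option qpath :=
  if path_target p == path_source q
  then insub (path_source p, path_arrows p ++ path_arrows q) : option qpath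
  else None.

Lemma walk_cat v s t :
  walk v (s ++ t) = walk v s && walk (last v (map (@target Q) s)) t.
Proof. by elim: s v => //= a s IHs v; rewrite IHs andbA. Qed.

Lemma path_catP (p q : qpath) : path_target p = path_source q ->
  exists2 r, path_cat p q = Some r &
    val r = (path_source p, path_arrows p ++ path_arrows q).
Proof.
move=> pq; rewrite /path_cat pq eqxx.
case: insubP => [r _ vr|]; first by exists r.
rewrite /= walk_cat -[last _ _]/(path_target p) pq.
by rewrite (valP p : walk (path_source p) _) (valP q : walk (path_source q) _).
Qed.

Lemma path_cat_None (p q : qpath) :
  path_target p != path_source q -> path_cat p q = None.
Proof. by rewrite /path_cat => /negPf->. Qed.

Lemma path_catA (p q r : qpath) :
  obind (path_cat p) (path_cat q r) = obind (path_cat^~ r) (path_cat p q).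
Proof.
have [pq|npq] := eqVneq (path_target p) (path_source q); last first.
  rewrite (path_cat_None npq).
  have [qr|nqr] := eqVneq (path_target q) (path_source r); last first.
    by rewrite (path_cat_None nqr).
  have [s -> vs] := path_catP qr.
  by rewrite /= path_cat_None // /path_source vs.
have [s -> vs] := path_catP pq.
have ts : path_target s = path_target q.
  rewrite /path_target /path_source /path_arrows vs /= map_cat last_cat.
  by rewrite -[last (path_source p) _]/(path_target p) pq.
have [qr|nqr] := eqVneq (path_target q) (path_source r); last first.
  by rewrite (path_cat_None nqr) /= path_cat_None // ts.
have [t -> vt] := path_catP qr.
have pt : path_target p = path_source t by rewrite pq /path_source vt.
have sr : path_target s = path_source r by rewrite ts.
have [u /= -> vu] := path_catP pt; have [w -> vw] := path_catP sr.
congr Some; apply: val_inj; rewrite [LHS]vu [RHS]vw.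
by rewrite /path_arrows /path_source vt vs /= catA.
Qed.

Lemma path_cat1p v (p : qpath) :
  path_cat (trivial_path v) p = if path_source p == v then Some p else None.
Proof.
have [<-|nv] := eqVneq (path_source p) v; last first.
  by rewrite path_cat_None // eq_sym.
have [//|r -> vr] := @path_catP (trivial_path (path_source p)) p.
by congr Some; apply: val_inj; rewrite [LHS]vr; case: p {r vr} => [[]].
Qed.

Lemma path_catp1 v (p : qpath) :
  path_cat p (trivial_path v) = if path_target p == v then Some p else None.
Proof.
have [pv|nv] := eqVneq (path_target p) v; last by rewrite path_cat_None.
have [//|r -> vr] := @path_catP p (trivial_path v).
congr Some; apply: val_inj; rewrite [LHS]vr.
by rewrite cats0; case: p {r vr pv} => [[]].
Qed.

End Paths.

Definition path_algebra (K : fieldType) (Q : quiver) : Type :=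
  {malg K[qpath Q]}.

Section PathAlgebra.
Variables (K : fieldType) (Q : quiver).
Local Notation KQ := (path_algebra K Q).

HB.instance Definition _ := GRing.Lmodule.on KQ.

Fact path_elt_key : unit. Proof. by []. Qed.
Definition path_elt : qpath Q -> KQ :=
  locked_with path_elt_key (fun p => << p >>).

Lemma path_eltE p : path_elt p = << p >>.
Proof. by rewrite /path_elt unlock. Qed.

Definition path_mul (p q : qpath Q) : KQ := oapp path_elt 0 (path_cat p q).

Definition pa_one : KQ := \sum_(v : vertex Q) path_elt (trivial_path v).

Fact pa_mul_key : unit. Proof. by []. Qed.
Definition pa_mul : KQ -> KQ -> KQ := locked_with pa_mul_key (fun x y =>
  \sum_(p <- msupp x) \sum_(q <- msupp y) (x@_p * y@_q) *: path_mul p q).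

Lemma pa_mul_def x y : pa_mul x y =
  \sum_(p <- msupp x) \sum_(q <- msupp y) (x@_p * y@_q) *: path_mul p q.
Proof. by rewrite /pa_mul unlock. Qed.

Lemma pa_mulw (c d : {fset qpath Q}) (x y : KQ) :
  (msupp x `<=` c)%fset -> (msupp y `<=` d)%fset ->
  pa_mul x y = \sum_(p <- c) \sum_(q <- d) (x@_p * y@_q) *: path_mul p q.
Proof.
move=> xc yd; rewrite pa_mul_def (big_fset_incl _ xc) /=.
  apply/eq_bigr => p _; apply/big_fset_incl => // q _ /mcoeff_outdom ->.
  by rewrite mulr0 scale0r.
move=> p _ /mcoeff_outdom xp.
by rewrite big1 // => q _; rewrite xp mul0r scale0r.
Qed.

Lemma pa_mulDl : left_distributive pa_mul +%R.
Proof.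
move=> x y z.
rewrite [in RHS](pa_mulw (fsubsetUl _ (msupp y)) (fsubset_refl _)).
rewrite [in RHS](pa_mulw (fsubsetUr (msupp x) _) (fsubset_refl _)).
rewrite (pa_mulw (msuppD_le _ _) (fsubset_refl _)) -big_split /=.
apply/eq_bigr => p _; rewrite -big_split /=; apply/eq_bigr => q _.
by rewrite mcoeffD mulrDl scalerDl.
Qed.

Lemma pa_mulDr : right_distributive pa_mul +%R.
Proof.
move=> z x y.
rewrite [in RHS](pa_mulw (fsubset_refl _) (fsubsetUl _ (msupp y))).
rewrite [in RHS](pa_mulw (fsubset_refl _) (fsubsetUr (msupp x) _)).
rewrite (pa_mulw (fsubset_refl _) (msuppD_le _ _)) -big_split /=.
apply/eq_bigr => p _; rewrite -big_split /=; apply/eq_bigr => q _.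
by rewrite mcoeffD mulrDr scalerDl.
Qed.

Lemma pa_mul0l y : pa_mul 0 y = 0.
Proof. by rewrite pa_mul_def msupp0 big_seq_fset0. Qed.

Lemma pa_mul0r x : pa_mul x 0 = 0.
Proof. by rewrite pa_mul_def big1 // => p _; rewrite msupp0 big_seq_fset0. Qed.

Lemma pa_mul_suml (T : Type) (r : seq T) (F : T -> KQ) y :
  pa_mul (\sum_(i <- r) F i) y = \sum_(i <- r) pa_mul (F i) y.
Proof. exact: (big_morph (pa_mul^~ y) (fun _ _ => pa_mulDl _ _ _) (pa_mul0l y)). Qed.

Lemma pa_mul_sumr (T : Type) (r : seq T) (F : T -> KQ) x :
  pa_mul x (\sum_(i <- r) F i) = \sum_(i <- r) pa_mul x (F i).
Proof. exact: (big_morph (pa_mul x) (fun _ _ => pa_mulDr _ _ _) (pa_mul0r x)). Qed.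

Lemma pa_mulZl a x y : pa_mul (a *: x) y = a *: pa_mul x y.
Proof.
rewrite (pa_mulw (msuppZ_le _ _) (fsubset_refl _)) pa_mul_def scaler_sumr.
apply/eq_bigr => p _; rewrite scaler_sumr; apply/eq_bigr => q _.
by rewrite mcoeffZ -mulrA scalerA.
Qed.

Lemma pa_mulZr a x y : pa_mul x (a *: y) = a *: pa_mul x y.
Proof.
rewrite (pa_mulw (fsubset_refl _) (msuppZ_le _ _)) pa_mul_def scaler_sumr.
apply/eq_bigr => p _; rewrite scaler_sumr; apply/eq_bigr => q _.
by rewrite mcoeffZ mulrCA scalerA.
Qed.

Lemma pa_mulE p q : pa_mul (path_elt p) (path_elt q) = path_mul p q.
Proof.
rewrite !path_eltE (pa_mulw msuppU_le msuppU_le) !big_seq_fset1 !mcoeffUU mulr1.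
exact: scale1r.
Qed.

Lemma pa_decomp (x : KQ) : x = \sum_(p <- msupp x) x@_p *: path_elt p.
Proof.
rewrite {1}[x]monalgE; apply/eq_bigr => p _; apply/malgP => q.
by rewrite [RHS]mcoeffZ [LHS]mcoeffU path_eltE mcoeffU mulr_natr.
Qed.

Lemma pa_ext (f g : KQ -> KQ) :
  {morph f : x y / x + y} -> (forall a, {morph f : x / a *: x}) ->
  {morph g : x y / x + y} -> (forall a, {morph g : x / a *: x}) ->
  (forall p, f (path_elt p) = g (path_elt p)) -> f =1 g.
Proof.
move=> fD fZ gD gZ fg x.
have f0 : f 0 = 0 by have := fZ 0 0; rewrite !scale0r.
have g0 : g 0 = 0 by have := gZ 0 0; rewrite !scale0r.
rewrite (pa_decomp x) (big_morph f fD f0) (big_morph g gD g0).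
by apply/eq_bigr => p _; rewrite fZ gZ fg.
Qed.

Lemma pa_mulA : associative pa_mul.
Proof.
move=> x y z; move: x.
apply: pa_ext => [? ?|? ?|? ?|? ?|p].
- by rewrite pa_mulDl.
- by rewrite pa_mulZl.
- by rewrite pa_mulDl pa_mulDl.
- by rewrite pa_mulZl pa_mulZl.
move: y; apply: pa_ext => [? ?|? ?|? ?|? ?|q].
- by rewrite pa_mulDl pa_mulDr.
- by rewrite pa_mulZl pa_mulZr.
- by rewrite pa_mulDr pa_mulDl.
- by rewrite pa_mulZr pa_mulZl.
move: z; apply: pa_ext => [? ?|? ?|? ?|? ?|r].
- by rewrite !pa_mulDr.
- by rewrite !pa_mulZr.
- by rewrite !pa_mulDr.
- by rewrite !pa_mulZr.
rewrite !pa_mulE /path_mul.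
transitivity (oapp path_elt 0 (obind (path_cat p) (path_cat q r))).
  by case: path_cat => [s|] /=; rewrite ?pa_mul0r ?pa_mulE.
by rewrite path_catA; case: path_cat => [s|] /=; rewrite ?pa_mul0l ?pa_mulE.
Qed.

Lemma pa_mul1l : left_id pa_one pa_mul.
Proof.
apply: pa_ext => [? ?|? ?|//|//|p]; rewrite ?pa_mulDr ?pa_mulZr //.
rewrite /pa_one pa_mul_suml (bigD1 (path_source p)) //= big1 => [|v nv].
  by rewrite pa_mulE /path_mul path_cat1p eqxx addr0.
by rewrite pa_mulE /path_mul path_cat1p eq_sym (negPf nv).
Qed.

Lemma pa_mul1r : right_id pa_one pa_mul.
Proof.
apply: (@pa_ext (pa_mul^~ pa_one) id) => [? ?|? ?|//|//|p].
- by rewrite pa_mulDl.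
- by rewrite pa_mulZl.
rewrite /pa_one pa_mul_sumr (bigD1 (path_target p)) //= big1 => [|v nv].
  by rewrite pa_mulE /path_mul path_catp1 eqxx addr0.
by rewrite pa_mulE /path_mul path_catp1 eq_sym (negPf nv).
Qed.

HB.instance Definition _ := GRing.Zmodule_isPzRing.Build KQ
  pa_mulA pa_mul1l pa_mul1r pa_mulDl pa_mulDr.

End PathAlgebra.

Arguments path_elt {K Q} p.

Record ideal (R : pzRingType) := Ideal {
  ideal_mem :> R -> Prop;
  ideal0 : ideal_mem 0;
  idealD : forall x y, ideal_mem x -> ideal_mem y -> ideal_mem (x + y);
  idealMl : forall a x, ideal_mem x -> ideal_mem (a * x);
  idealMr : forall a x, ideal_mem x -> ideal_mem (x * a)
}.

(* Hence ring ideals of KQ are algebra ideals, and only the ring structure of *)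
(* the quotients is recorded.                                                 *)
Lemma ideal_path_algebraZ (K : fieldType) (Q : quiver)
  (I : ideal (path_algebra K Q)) (a : K) x : I x -> I (a *: x).
Proof.
by move=> Ix; rewrite -[x]mul1r -[a *: _]pa_mulZl; apply: idealMl.
Qed.

Section GeneratedIdeal.
Variables (R : pzRingType) (S : R -> Prop).

Definition gen_ideal_mem (x : R) : Prop :=
  forall J : ideal R, (forall s, S s -> J s) -> J x.

Definition gen_ideal : ideal R.
Proof.
exists gen_ideal_mem.
- by move=> J _; apply: ideal0.
- by move=> x y Ix Iy J SJ; apply: idealD; [apply: Ix|apply: Iy].
- by move=> a x Ix J SJ; apply/idealMl/Ix.
- by move=> a x Ix J SJ; apply/idealMr/Ix.
Defined.

End GeneratedIdeal.

Section QuotientRing.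
Variables (R : pzRingType) (I : ideal R).
Local Open Scope quotient_scope.

Definition ideal_pred : {pred R} := fun x => `[< I x >].

Lemma ideal_pred_zmod_closed : zmod_closed ideal_pred.
Proof.
split=> [|x y /asboolP Ix /asboolP Iy]; first exact/asboolP/ideal0.
by apply/asboolP/idealD => //; rewrite -mulN1r; apply: idealMl.
Qed.
HB.instance Definition _ :=
  GRing.isZmodClosed.Build R ideal_pred ideal_pred_zmod_closed.

Definition quot_ring : Type := {ideal_quot ideal_pred}.
HB.instance Definition _ := GRing.Zmodule.on quot_ring.
HB.instance Definition _ := EqQuotient.on quot_ring.

Definition quot_proj (x : R) : quot_ring := \pi_{ideal_quot ideal_pred} x.

Lemma quot_projP x y : quot_proj x = quot_proj y <-> I (x - y).
Proof.
rewrite /quot_proj; split=> [/eqP|Ixy].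
  by rewrite -Quotient.idealrBE => /asboolP.
by apply/eqP; rewrite -Quotient.idealrBE; apply/asboolP.
Qed.

Definition quot_repr (x : quot_ring) : R := repr (x : {ideal_quot ideal_pred}).

Lemma quot_reprK : cancel quot_repr quot_proj.
Proof. exact: reprK. Qed.

Definition quot_one : quot_ring := quot_proj 1.
Definition quot_mul (x y : quot_ring) : quot_ring :=
  quot_proj (quot_repr x * quot_repr y).

Lemma quot_projD : {morph quot_proj : x y / x + y}.
Proof. exact: Quotient.pi_add. Qed.

Lemma quot_projM : {morph quot_proj : x y / x * y >-> quot_mul x y}.
Proof.
move=> x y; apply/quot_projP.
set x' := quot_repr _; set y' := quot_repr _.
have Ix : I (x - x') by apply/quot_projP; rewrite quot_reprK.
have Iy : I (y - y') by apply/quot_projP; rewrite quot_reprK.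
have -> : x * y - x' * y' = (x - x') * y + x' * (y - y').
  by rewrite mulrBl mulrBr addrA subrK.
by apply: idealD; [apply: idealMr | apply: idealMl].
Qed.

Lemma quot_mulA : associative quot_mul.
Proof.
move=> x y z; rewrite -[x]quot_reprK -[y]quot_reprK -[z]quot_reprK.
by rewrite -!quot_projM mulrA.
Qed.
Lemma quot_mul1l : left_id quot_one quot_mul.
Proof. by move=> x; rewrite -[x]quot_reprK -quot_projM mul1r. Qed.
Lemma quot_mul1r : right_id quot_one quot_mul.
Proof. by move=> x; rewrite -[x]quot_reprK -quot_projM mulr1. Qed.
Lemma quot_mulDl : left_distributive quot_mul +%R.
Proof.
move=> x y z; rewrite -[x]quot_reprK -[y]quot_reprK -[z]quot_reprK.
by rewrite -!(quot_projM, quot_projD) mulrDl.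
Qed.
Lemma quot_mulDr : right_distributive quot_mul +%R.
Proof.
move=> x y z; rewrite -[x]quot_reprK -[y]quot_reprK -[z]quot_reprK.
by rewrite -!(quot_projM, quot_projD) mulrDr.
Qed.

HB.instance Definition _ := GRing.Zmodule_isPzRing.Build quot_ring
  quot_mulA quot_mul1l quot_mul1r quot_mulDl quot_mulDr.

Lemma quot_proj_zmod_morphism : zmod_morphism quot_proj.
Proof. by move=> x y; apply: (raddfB (\pi_{ideal_quot ideal_pred})). Qed.
Lemma quot_proj_monoid_morphism : monoid_morphism quot_proj.
Proof. by split; last exact: quot_projM. Qed.
HB.instance Definition _ :=
  GRing.isZmodMorphism.Build R quot_ring quot_proj quot_proj_zmod_morphism.
HB.instance Definition _ :=
  GRing.isMonoidMorphism.Build R quot_ring quot_proj quot_proj_monoid_morphism.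

End QuotientRing.

Record subquiver (Q : quiver) := Subquiver {
  sub_vertex : {set vertex Q};
  sub_arrow : {set arrow Q};
  sub_arrowP : forall a, a \in sub_arrow ->
    source a \in sub_vertex /\ target a \in sub_vertex
}.

Definition full (Q : quiver) (L : subquiver Q) : Prop :=
  forall a : arrow Q, source a \in sub_vertex L -> target a \in sub_vertex L ->
    a \in sub_arrow L.

Definition convex (Q : quiver) (L : subquiver Q) : Prop :=
  full L /\
  forall p : qpath Q,
    path_source p \in sub_vertex L -> path_target p \in sub_vertex L ->
    {in path_vertices p, forall v, v \in sub_vertex L}.

Section AssociatedAlgebra.
Variables (K : fieldType) (Q : quiver).

Definition paths_of_length (n : nat) (x : path_algebra K Q) : Prop :=
  exists2 p : qpath Q, path_length p = n & x = path_elt p.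

Variables (I : ideal (path_algebra K Q)) (L : subquiver Q).

(* e'_L *)
Definition co_idempotent : quot_ring I :=
  \sum_(v | v \notin sub_vertex L) quot_proj I (path_elt (trivial_path v)).

(* The ideal <e'_L> of KQ / I; the algebra associated to (L, KQ / I) is the   *)
(* quotient by it.                                                            *)
Definition co_ideal : ideal (quot_ring I) :=
  gen_ideal (fun x => x = co_idempotent).

End AssociatedAlgebra.

(* Categories with a designated equality of morphisms: hom_eq is the equality *)
(* of the actual hom-sets, which are the quotients of hom X Y by hom_eq.      *)
Record category := Category {
  obj :> Type;
  hom : obj -> obj -> Type;
  hom_eq : forall X Y, hom X Y -> hom X Y -> Prop;
  idm : forall X, hom X X;
  comp : forall X Y Z, hom Y Z -> hom X Y -> hom X Z;
  hom_refl : forall X Y (f : hom X Y), hom_eq f f;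
  hom_sym : forall X Y (f g : hom X Y), hom_eq f g -> hom_eq g f;
  hom_trans : forall X Y (f g h : hom X Y),
    hom_eq f g -> hom_eq g h -> hom_eq f h;
  comp_eq : forall X Y Z (g g' : hom Y Z) (f f' : hom X Y),
    hom_eq g g' -> hom_eq f f' -> hom_eq (comp g f) (comp g' f');
  comp1m : forall X Y (f : hom X Y), hom_eq (comp (idm Y) f) f;
  compm1 : forall X Y (f : hom X Y), hom_eq (comp f (idm X)) f;
  compA : forall X Y Z T (h : hom Z T) (g : hom Y Z) (f : hom X Y),
    hom_eq (comp h (comp g f)) (comp (comp h g) f)
}.

Record functor (C D : category) := Functor {
  fobj :> C -> D;
  fhom : forall X Y, hom X Y -> hom (fobj X) (fobj Y);
  fhom_eq : forall X Y (f g : hom X Y), hom_eq f g -> hom_eq (fhom f) (fhom g);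
  fhom1 : forall X, hom_eq (fhom (idm X)) (idm (fobj X));
  fhomM : forall X Y Z (g : hom Y Z) (f : hom X Y),
    hom_eq (fhom (comp g f)) (comp (fhom g) (fhom f))
}.

Definition faithful (C D : category) (F : functor C D) : Prop :=
  forall X Y (f g : hom X Y), hom_eq (fhom F f) (fhom F g) -> hom_eq f g.

Definition full_functor (C D : category) (F : functor C D) : Prop :=
  forall X Y (g : hom (F X) (F Y)), exists f : hom X Y, hom_eq (fhom F f) g.

Definition fully_faithful (C D : category) (F : functor C D) : Prop :=
  full_functor F /\ faithful F.

Definition morphism_class (C : category) : Type :=
  forall X Y : C, hom X Y -> Prop.

(* The localization C[W^-1]: same objects; morphisms are the formal           *)
(* composites of morphisms of C and of formal inverses of morphisms in W,     *)
(* modulo the smallest congruence making C -> C[W^-1] a functor and the       *)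
(* formal inverses inverses.                                                  *)
Section Localization.
Variables (C : category) (W : morphism_class C).

Inductive loc_hom : C -> C -> Type :=
| loc_of X Y (f : hom X Y) : loc_hom X Y
| loc_inv X Y (s : hom X Y) (Ws : W s) : loc_hom Y X
| loc_comp X Y Z (g : loc_hom Y Z) (f : loc_hom X Y) : loc_hom X Z.

Inductive loc_eq : forall X Y : C, loc_hom X Y -> loc_hom X Y -> Prop :=
| loc_refl X Y (f : loc_hom X Y) : loc_eq f f
| loc_sym X Y (f g : loc_hom X Y) : loc_eq f g -> loc_eq g f
| loc_trans X Y (f g h : loc_hom X Y) :
    loc_eq f g -> loc_eq g h -> loc_eq f h
| loc_comp_eq X Y Z (g g' : loc_hom Y Z) (f f' : loc_hom X Y) :
    loc_eq g g' -> loc_eq f f' -> loc_eq (loc_comp g f) (loc_comp g' f')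
| loc_comp1m X Y (f : loc_hom X Y) : loc_eq (loc_comp (loc_of (idm Y)) f) f
| loc_compm1 X Y (f : loc_hom X Y) : loc_eq (loc_comp f (loc_of (idm X))) f
| loc_compA X Y Z T (h : loc_hom Z T) (g : loc_hom Y Z) (f : loc_hom X Y) :
    loc_eq (loc_comp h (loc_comp g f)) (loc_comp (loc_comp h g) f)
| loc_of_eq X Y (f g : hom X Y) : hom_eq f g -> loc_eq (loc_of f) (loc_of g)
| loc_ofM X Y Z (g : hom Y Z) (f : hom X Y) :
    loc_eq (loc_of (comp g f)) (loc_comp (loc_of g) (loc_of f))
| loc_invl X Y (s : hom X Y) (Ws : W s) :
    loc_eq (loc_comp (loc_inv Ws) (loc_of s)) (loc_of (idm X))
| loc_invr X Y (s : hom X Y) (Ws : W s) :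
    loc_eq (loc_comp (loc_of s) (loc_inv Ws)) (loc_of (idm Y)).

Definition localization : category :=
  @Category C loc_hom loc_eq (fun X => loc_of (idm X)) loc_comp
    loc_refl loc_sym loc_trans loc_comp_eq loc_comp1m loc_compm1 loc_compA.

End Localization.

Section LocalizedFunctor.
Variables (C D : category) (W : morphism_class C) (V : morphism_class D).
Variables (F : functor C D).
Hypothesis FW : forall (X Y : C) (s : hom X Y), W s -> V (fhom F s).

Fixpoint loc_map (X Y : C) (f : loc_hom W X Y) : loc_hom V (F X) (F Y) :=
  match f with
  | loc_of _ _ f => loc_of V (fhom F f)
  | loc_inv _ _ _ Ws => loc_inv (FW Ws)
  | loc_comp _ _ _ g f => loc_comp (loc_map g) (loc_map f)
  end.

Lemma loc_map_eq (X Y : C) (f g : loc_hom W X Y) :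
  loc_eq f g -> loc_eq (loc_map f) (loc_map g).
Proof.
elim=> {X Y f g} /=.
- by move=> *; apply: loc_refl.
- by move=> *; apply: loc_sym.
- by move=> X Y f g h _ fg _ gh; apply: loc_trans fg gh.
- by move=> *; apply: loc_comp_eq.
- move=> X Y f; apply: loc_trans (loc_comp1m _).
  by apply: loc_comp_eq (loc_refl _); apply/loc_of_eq/fhom1.
- move=> X Y f; apply: loc_trans (loc_compm1 _).
  by apply: loc_comp_eq (loc_refl _) _; apply/loc_of_eq/fhom1.
- by move=> *; apply: loc_compA.
- by move=> *; apply/loc_of_eq/fhom_eq.
- move=> X Y Z g f; apply: loc_trans (loc_ofM _ _ _).
  by apply/loc_of_eq/fhomM.
- move=> X Y s Ws; apply: loc_trans (loc_invl _) _.
  by apply/loc_sym/loc_of_eq/fhom1.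
- move=> X Y s Ws; apply: loc_trans (loc_invr _) _.
  by apply/loc_sym/loc_of_eq/fhom1.
Qed.

Definition localized_functor : functor (localization W) (localization V) :=
  @Functor (localization W) (localization V) F loc_map loc_map_eq
    (fun X => loc_of_eq V (fhom1 F X))
    (fun X Y Z g f => loc_refl (loc_comp (loc_map g) (loc_map f))).

End LocalizedFunctor.

Section Complexes.
Variable A : pzRingType.

Record complex := Complex {
  term : int -> lmodType A^c;
  diff : forall n, {linear term n -> term (n + 1)};
  diff_diff : forall n x, diff (n + 1) (diff n x) = 0;
  bounded : exists b : nat, forall n : int,
    (b < absz n)%N -> forall x : term n, x = 0
}.

Record chain_map (X Y : complex) := ChainMap {
  cm :> forall n, {linear term X n -> term Y n};
  cm_diff : forall n x, cm (n + 1) (diff X n x) = diff Y n (cm n x)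
}.

Definition chain_map_eq (X Y : complex) (f g : chain_map X Y) : Prop :=
  forall n, f n =1 g n.

Definition chain_map_id (X : complex) : chain_map X X :=
  @ChainMap X X (fun n => idfun) (fun n x => erefl).

Lemma chain_map_comp_diff (X Y Z : complex) (g : chain_map Y Z)
  (f : chain_map X Y) n x :
  (g (n + 1) \o f (n + 1)) (diff X n x) = diff Z n ((g n \o f n) x).
Proof. by rewrite /= !cm_diff. Qed.

Definition chain_map_comp (X Y Z : complex) (g : chain_map Y Z)
    (f : chain_map X Y) : chain_map X Z :=
  @ChainMap X Z (fun n => g n \o f n) (chain_map_comp_diff g f).

(* C^b(mod A) *)
Definition complexes : category.
Proof.
apply: (@Category complex chain_map chain_map_eq chain_map_id chain_map_comp).
- by move=> X Y f n x.
- by move=> X Y f g fg n x; rewrite fg.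
- by move=> X Y f g h fg gh n x; rewrite fg gh.
- by move=> X Y Z g g' f f' gg' ff' n x /=; rewrite ff' gg'.
- by move=> X Y f n x.
- by move=> X Y f n x.
- by move=> X Y Z T h g f n x.
Defined.

(* The map induced by f on H^{n+1} = ker d^{n+1} / im d^n is injective and     *)
(* surjective, for all n.                                                     *)
Definition quasi_iso : morphism_class complexes :=
  fun X Y (f : chain_map X Y) => forall n : int,
    (forall x, diff X (n + 1) x = 0 ->
       (exists y, f (n + 1) x = diff Y n y) -> exists x', x = diff X n x') /\
    (forall y, diff Y (n + 1) y = 0 ->
       exists2 x, diff X (n + 1) x = 0 &
         exists y', y - f (n + 1) x = diff Y n y').

(* D^b(mod A), as the localization of C^b(mod A) at the quasi-isomorphisms;    *)
(* homotopic maps become equal in it, so there is no need to pass to the      *)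
(* homotopy category first.                                                   *)
Definition derived_category : category := localization quasi_iso.

End Complexes.

Section Restriction.
Variables (A B : pzRingType) (f : {rmorphism A -> B}).

Section Module.
Variable M : lmodType B^c.

Definition restr : Type := M.
HB.instance Definition _ := GRing.Zmodule.on restr.

Definition restr_scale (a : A^c) (m : restr) : restr :=
  (f a : B^c) *: (m : M).

Lemma restr_scaleA a b m :
  restr_scale a (restr_scale b m) = restr_scale (a * b) m.
Proof. by rewrite /restr_scale scalerA; congr (_ *: _); rewrite rmorphM. Qed.
Lemma restr_scale1 : left_id 1 restr_scale.
Proof. by move=> m; rewrite /restr_scale rmorph1 scale1r. Qed.
Lemma restr_scaleDr : right_distributive restr_scale +%R.
Proof. by move=> a m n; apply: scalerDr. Qed.
Lemma restr_scaleDl m : {morph restr_scale^~ m : a b / a + b}.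
Proof. by move=> a b; rewrite /restr_scale rmorphD; apply: scalerDl. Qed.

HB.instance Definition _ := GRing.Zmodule_isLmodule.Build A^c restr
  restr_scaleA restr_scale1 restr_scaleDr restr_scaleDl.
End Module.

Section Morphism.
Variables (M N : lmodType B^c) (g : {linear M -> N}).

Definition restr_map (m : restr M) : restr N := g m.

Lemma restr_map_linear : linear restr_map.
Proof. by move=> a m n; apply: linearP. Qed.
HB.instance Definition _ :=
  GRing.isLinear.Build A^c (restr M) (restr N) _ restr_map restr_map_linear.
End Morphism.

Definition restr_complex (X : complex B) : complex A :=
  @Complex A (fun n => restr (term X n)) (fun n => restr_map (diff X n))
    (@diff_diff B X) (bounded X).

Definition restr_chain_map (X Y : complex B) (g : chain_map X Y) :
    chain_map (restr_complex X) (restr_complex Y) :=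
  @ChainMap A (restr_complex X) (restr_complex Y)
    (fun n => restr_map (g n)) (cm_diff g).

Definition restr_complexes : functor (complexes B) (complexes A).
Proof.
apply: (@Functor (complexes B) (complexes A) restr_complex restr_chain_map).
- by move=> X Y g h gh n x; apply: gh.
- by move=> X n x.
- by move=> X Y Z h g n x.
Defined.

Lemma restr_quasi_iso (X Y : complexes B) (g : hom X Y) :
  quasi_iso g -> quasi_iso (fhom restr_complexes g).
Proof. exact. Qed.

Definition restr_derived :
    functor (derived_category B) (derived_category A) :=
  localized_functor restr_quasi_iso.

Definition ring_epimorphism : Prop :=
  forall (C : pzRingType) (g h : {rmorphism B -> C}),
    g \o f =1 h \o f -> g =1 h.

Definition homological_epimorphism : Prop :=
  ring_epimorphism /\ fully_faithful restr_derived.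

End Restriction.

(* Main.v *)
(* Let R be the set of vertices reachable from L, and let v and w be the sums  *)
(* of the vertices in R and in L, viewed in Lambda.  No path leaves R, and by  *)
(* convexity none leads from R \ L to L, so v x = v x v and v x w = w x w for  *)
(* all x.  Hence w Lambda w is Gamma, and for a right Lambda-module M the      *)
(* subgroup M v is a submodule, with M w as a quotient.  Thus T M = M v and    *)
(* F M = M w are exact functors to Lambda- and Gamma-modules, with natural     *)
(* maps Id <- T -> restr F that are invertible on restricted modules, and      *)
(* F restr = Id; so F is inverse to restriction on morphisms, also after       *)
(* localization at the quasi-isomorphisms.                                     *)

Require Import Defs.
From HB Require Import structures.
From mathcomp Require Import all_boot all_order all_algebra.
From mathcomp Require Import boolp.
Import Defs.

Set Implicit Arguments.
Unset Strict Implicit.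
Unset Printing Implicit Defensive.

Import GRing.Theory.
Local Open Scope ring_scope.

(** Full faithfulness is obtained from exact functors alone, without resolutions: cutting modules by
    an idempotent is exact, so it acts termwise on complexes and respects quasi-isomorphisms
    ([corner_quasi_iso]). Two facts about paths feed the construction. Nothing leaves the set of
    vertices reachable from L ([reachable_target]), and by convexity nothing returns to L from a
    reachable vertex outside L ([convex_reachable]). Together they make the ideal of e'_L vanish in
    w Lambda w ([gen_ideal_corner]), so that this corner is Gamma and M w is a Gamma-module. The map
    m |-> m w from M to M w is in general not Lambda-linear, but its restriction to the submodule M
    v is; hence the roof M <- M v -> M w. On a Gamma-module v and w act as 1 and both legs are
    isomorphisms. The formal argument [fully_faithful_of_roof] then rebuilds each morphism between
    restricted complexes from its image under F. *)

Definition functor_id (C : category) : functor C C :=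
  @Functor C C id (fun _ _ f => f) (fun _ _ _ _ e => e)
    (fun X => hom_refl (idm X)) (fun _ _ _ g f => hom_refl (comp g f)).

Definition functor_comp (C D E : category) (G : functor D E) (F : functor C D) :
  functor C E.
Proof.
apply: (@Functor C E (fun X => G (F X)) (fun _ _ f => fhom G (fhom F f))).
- by move=> X Y f g fg; do 2!apply: fhom_eq.
- by move=> X; apply: hom_trans (fhom1 G _); apply/fhom_eq/fhom1.
- by move=> X Y Z g f; apply: hom_trans (fhomM _ _ _); apply/fhom_eq/fhomM.
Defined.

Definition natural (C D : category) (F G : functor C D)
    (t : forall X, hom (F X) (G X)) : Prop :=
  forall X Y (f : hom X Y),
    hom_eq (comp (fhom G f) (t X)) (comp (t Y) (fhom F f)).

(** * A formal criterion for full faithfulness *)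

Section FullyFaithful.
Variables (C D : category) (R : functor C D) (F : functor D C) (T : functor D D).
Variables (k : forall X, hom (F (R X)) X) (j : forall X, hom X (F (R X))).
Variables (i : forall Y, hom (T Y) Y) (i' : forall X, hom (R X) (T (R X))).
Variable p : forall Y, hom (T Y) (R (F Y)).
Arguments k : clear implicits.
Arguments j : clear implicits.
Arguments i : clear implicits.
Arguments i' : clear implicits.
Arguments p : clear implicits.
Hypothesis k_nat : natural (F := functor_comp F R) (G := functor_id C) k.
Hypothesis i_nat : natural (F := T) (G := functor_id D) i.
Hypothesis p_nat : natural (F := T) (G := functor_comp R F) p.
Hypothesis kj : forall X, hom_eq (comp (k X) (j X)) (idm X).
Hypothesis ii' : forall X, hom_eq (comp (i (R X)) (i' X)) (idm (R X)).
Hypothesis p_def : forall X, hom_eq (p (R X)) (comp (fhom R (j X)) (i (R X))).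

(** This gives faithfulness: f is recovered from F (R f) by naturality of k and k j = 1. *)
Lemma conj_retract X Y (f : hom X Y) :
  hom_eq (comp (k Y) (comp (fhom F (fhom R f)) (j X))) f.
Proof.
apply: hom_trans (compA _ _ _) _.
apply: hom_trans (comp_eq (hom_sym (k_nat f)) (hom_refl _)) _.
apply: hom_trans (hom_sym (compA _ _ _)) _.
by apply: hom_trans (comp_eq (hom_refl _) (kj X)) _; apply: compm1.
Qed.

Lemma fhom_kp Y : hom_eq (comp (fhom R (k Y)) (p (R Y))) (i (R Y)).
Proof.
apply: hom_trans (comp_eq (hom_refl _) (p_def Y)) _.
apply: hom_trans (compA _ _ _) _.
apply: hom_trans (comp_eq _ (hom_refl _)) (comp1m _).
apply: hom_trans (hom_sym (fhomM _ _ _)) _.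
by apply: hom_trans (fhom1 R Y); apply/fhom_eq/kj.
Qed.

Lemma fhom_j X : hom_eq (fhom R (j X)) (comp (p (R X)) (i' X)).
Proof.
apply: hom_sym.
apply: hom_trans (comp_eq (p_def X) (hom_refl _)) _.
apply: hom_trans (hom_sym (compA _ _ _)) _.
by apply: hom_trans (comp_eq (hom_refl _) (ii' X)) _; apply: compm1.
Qed.

(** Fullness is the chain R (k F(g) j) = R k . RF g . R j = R k . RF g . p i' = R k . p . T g . i' =
    i . T g . i' = g . i i' = g. The one-sided identities k j = 1 and i i' = 1 suffice, and neither
    j nor i' has to be natural. *)
Lemma fully_faithful_of_roof : fully_faithful R.
Proof.
split=> [X Y g|X Y f g fg].
  exists (comp (k Y) (comp (fhom F g) (j X))).
  apply: hom_trans (fhomM _ _ _) _.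
  apply: hom_trans (comp_eq (hom_refl _) (fhomM _ _ _)) _.
  apply: hom_trans (comp_eq (hom_refl _) (comp_eq (hom_refl _) (fhom_j X))) _.
  apply: hom_trans (comp_eq (hom_refl _) (compA _ _ _)) _.
  apply: hom_trans (comp_eq (hom_refl _) (comp_eq (p_nat g) (hom_refl _))) _.
  apply: hom_trans (comp_eq (hom_refl _) (hom_sym (compA _ _ _))) _.
  apply: hom_trans (compA _ _ _) _.
  apply: hom_trans (comp_eq (fhom_kp Y) (hom_refl _)) _.
  apply: hom_trans (compA _ _ _) _.
  apply: hom_trans (comp_eq (hom_sym (i_nat g)) (hom_refl _)) _.
  apply: hom_trans (hom_sym (compA _ _ _)) _.
  by apply: hom_trans (comp_eq (hom_refl _) (ii' X)) _; apply: compm1.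
apply: hom_trans (hom_sym (conj_retract f)) _.
apply: hom_trans (conj_retract g).
by apply: comp_eq (hom_refl _) (comp_eq _ (hom_refl _)); apply: fhom_eq.
Qed.

End FullyFaithful.

(** * Natural transformations on a localization *)

Section NaturalLocalization.
Variables (C : category) (W : morphism_class C) (D : category).
Variables (F G : functor (localization W) D) (t : forall X : C, hom (F X) (G X)).
Arguments t : clear implicits.
Hypothesis t_nat : forall (X Y : C) (f : hom X Y),
  hom_eq (comp (fhom G (loc_of W f : hom (X : localization W) Y)) (t X))
         (comp (t Y) (fhom F (loc_of W f : hom (X : localization W) Y))).

(** Morphisms of the localization are formal composites, and a naturality square for s gives one for
    its inverse, since F and G send s to an isomorphism. *)
Lemma natural_localization : natural (F := F) (G := G) t.
Proof.
move=> X Y g; elim: g => {X Y} [//|X Y s Ws|X Y Z g IHg f IHf].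
  set s' := loc_of W s : hom (X : localization W) Y.
  set r := loc_inv Ws : hom (Y : localization W) X.
  have FsK : hom_eq (comp (fhom F s') (fhom F r)) (idm (F Y)).
    apply: hom_trans (hom_sym (fhomM _ _ _)) (hom_trans _ (fhom1 F Y)).
    exact/fhom_eq/loc_invr.
  have GsK : hom_eq (comp (fhom G r) (fhom G s')) (idm (G X)).
    apply: hom_trans (hom_sym (fhomM _ _ _)) (hom_trans _ (fhom1 G X)).
    exact/fhom_eq/loc_invl.
  apply: hom_trans (hom_sym (compm1 _)) _.
  apply: hom_trans (comp_eq (hom_refl _) (hom_sym FsK)) _.
  apply: hom_trans (compA _ _ _) (comp_eq _ (hom_refl _)).
  apply: hom_trans (hom_sym (compA _ _ _)) _.
  apply: hom_trans (comp_eq (hom_refl _) (hom_sym (t_nat s))) _.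
  apply: hom_trans (compA _ _ _) _.
  by apply: hom_trans (comp_eq GsK (hom_refl _)) (comp1m _).
apply: hom_trans (comp_eq (fhomM G _ _) (hom_refl _)) _.
apply: hom_trans (hom_sym (compA _ _ _)) _.
apply: hom_trans (comp_eq (hom_refl _) IHf) _.
apply: hom_trans (compA _ _ _) _.
apply: hom_trans (comp_eq IHg (hom_refl _)) _.
apply: hom_trans (hom_sym (compA _ _ _)) _.
exact: comp_eq (hom_refl _) (hom_sym (fhomM F _ _)).
Qed.

End NaturalLocalization.

(** * Cutting modules and complexes by an idempotent *)

Record nonunital_morphism (C A : pzRingType) := NonunitalMorphism {
  nonunital_fun :> C -> A;
  nonunitalD : {morph nonunital_fun : x y / x + y};
  nonunitalM : {morph nonunital_fun : x y / x * y}
}.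

(* Restriction of scalars along [h] turns [M] into the [C]-module [M h(1)].    *)
Section Corner.
Variables (C A : pzRingType) (h : nonunital_morphism C A).

(** Since [h 1] is idempotent, the image of right multiplication by it is its set of fixed points,
    which is a boolean condition. *)
Definition corner_pred (M : lmodType A^c) : {pred M} :=
  fun m => (h 1 : A^c) *: m == m.
Arguments corner_pred : clear implicits.

Section Module.
Variable M : lmodType A^c.

Lemma corner_zmod_closed : zmod_closed (corner_pred M).
Proof.
split=> [|x y /eqP xP /eqP yP]; rewrite unfold_in ?scaler0 //.
by rewrite scalerBr xP yP.
Qed.
HB.instance Definition _ :=
  GRing.isZmodClosed.Build M (corner_pred M) corner_zmod_closed.

Record corner : Type := Corner { corner_val : M; _ : corner_val \in corner_pred M }.
HB.instance Definition _ := [isSub for corner_val].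
HB.instance Definition _ := [Choice of corner by <:].
HB.instance Definition _ := [SubChoice_isSubZmodule of corner by <:].

Lemma corner1 (m : corner) : (h 1 : A^c) *: val m = val m.
Proof. exact/eqP/(valP m). Qed.

Lemma corner_scale_subproof (c : C) (m : M) :
  (h c : A^c) *: m \in corner_pred M.
Proof.
by rewrite unfold_in scalerA -[_ * _]/(h c * h 1 : A) -nonunitalM mulr1.
Qed.

Definition corner_scale (c : C^c) (m : corner) : corner :=
  Corner (corner_scale_subproof c (val m)).

Lemma corner_scaleA a b m :
  corner_scale a (corner_scale b m) = corner_scale (a * b) m.
Proof.
apply: val_inj; rewrite /= scalerA; congr (_ *: _).
by rewrite -[LHS]/(h b * h a : A) -nonunitalM.
Qed.
Lemma corner_scale1 : left_id 1 corner_scale.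
Proof. by move=> m; apply: val_inj; apply: corner1. Qed.
Lemma corner_scaleDr : right_distributive corner_scale +%R.
Proof. by move=> a m n; apply: val_inj; rewrite /= scalerDr. Qed.
Lemma corner_scaleDl m : {morph corner_scale^~ m : a b / a + b}.
Proof. by move=> a b; apply: val_inj; rewrite /= nonunitalD scalerDl. Qed.

HB.instance Definition _ := GRing.Zmodule_isLmodule.Build C^c corner
  corner_scaleA corner_scale1 corner_scaleDr corner_scaleDl.

Definition to_corner (m : M) : corner := Corner (corner_scale_subproof 1 m).

End Module.

Section Morphism.
Variables (M N : lmodType A^c) (g : {linear M -> N}).

Lemma corner_map_subproof (m : corner M) : g (val m) \in corner_pred N.
Proof. by rewrite unfold_in -linearZ corner1. Qed.

Definition corner_map (m : corner M) : corner N :=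
  Corner (corner_map_subproof m).

Lemma corner_map_linear : linear corner_map.
Proof. by move=> a m n; apply: val_inj; rewrite /= linearD linearZ. Qed.
HB.instance Definition _ :=
  GRing.isLinear.Build C^c (corner M) (corner N) _ corner_map corner_map_linear.
End Morphism.

Lemma corner_diff_diff (X : complex A) n (x : corner (term X n)) :
  corner_map (diff X (n + 1)) (corner_map (diff X n) x) = 0.
Proof. by apply: val_inj; rewrite /= diff_diff. Qed.

Lemma corner_bounded (X : complex A) : exists b : nat, forall n : int,
  (b < absz n)%N -> forall x : corner (term X n), x = 0.
Proof.
have [b bP] := bounded X; exists b => n bn x.
by apply: val_inj; apply: bP.
Qed.

Definition corner_complex (X : complex A) : complex C :=
  @Complex C (fun n => corner (term X n)) (fun n => corner_map (diff X n))
    (@corner_diff_diff X) (corner_bounded X).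

Lemma corner_cm_diff (X Y : complex A) (g : chain_map X Y) n
    (x : corner (term X n)) :
  corner_map (g (n + 1)) (corner_map (diff X n) x) =
  corner_map (diff Y n) (corner_map (g n) x).
Proof. by apply: val_inj; rewrite /= cm_diff. Qed.

Definition corner_chain_map (X Y : complex A) (g : chain_map X Y) :
    chain_map (corner_complex X) (corner_complex Y) :=
  @ChainMap C (corner_complex X) (corner_complex Y)
    (fun n => corner_map (g n)) (corner_cm_diff g).

Definition corner_complexes : functor (complexes A) (complexes C).
Proof.
apply: (@Functor (complexes A) (complexes C) corner_complex corner_chain_map).
- by move=> X Y f g fg n x; apply: val_inj; apply: fg.
- by move=> X n x; apply: val_inj.
- by move=> X Y Z g f n x; apply: val_inj.
Defined.

(** A cycle or a primitive found in the whole complex is moved into the corner by multiplying it by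
    [h 1]. This commutes with the linear maps and fixes the elements already in the corner. *)
Lemma corner_quasi_iso (X Y : complexes A) (g : hom X Y) :
  quasi_iso g -> quasi_iso (fhom corner_complexes g).
Proof.
move=> gW n; have [g_inj g_surj] := gW n; split=> [x dx [y gx]|y dy].
  have [||x' xx'] := g_inj (val x).
  - by have /= := congr1 val dx.
  - by exists (val y); have /= := congr1 val gx.
  exists (to_corner x'); apply: val_inj; rewrite /= linearZ_LR.
  by rewrite -xx'; apply/esym/corner1.
have [|x dx [y' yy']] := g_surj (val y).
  by have /= := congr1 val dy.
exists (to_corner x).
  by apply: val_inj; rewrite /= linearZ_LR dx scaler0.
exists (to_corner y'); apply: val_inj; rewrite /= !linearZ_LR -yy' scalerBr.
by rewrite corner1; congr (_ + _); apply: scalerN.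
Qed.

Definition corner_derived :
    functor (derived_category A) (derived_category C) :=
  localized_functor corner_quasi_iso.

End Corner.

Lemma loc_square (C : category) (W : morphism_class C) (X Y Y' Z : C)
    (g : hom Y Z) (f : hom X Y) (g' : hom Y' Z) (f' : hom X Y') :
  hom_eq (comp g f) (comp g' f') ->
  loc_eq (loc_comp (loc_of W g) (loc_of W f))
         (loc_comp (loc_of W g') (loc_of W f')).
Proof.
move=> e; apply: loc_trans (loc_sym (loc_ofM _ _ _)) _.
exact: loc_trans (loc_of_eq _ e) (loc_ofM _ _ _).
Qed.

Lemma loc_section (C : category) (W : morphism_class C) (X Y : C)
    (g : hom Y X) (f : hom X Y) :
  hom_eq (comp g f) (idm X) ->
  loc_eq (loc_comp (loc_of W g) (loc_of W f)) (loc_of W (idm X)).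
Proof.
by move=> e; apply: loc_trans (loc_sym (loc_ofM _ _ _)) (loc_of_eq _ e).
Qed.

(** * The roof attached to a surjection and two idempotents *)

Section IdempotentRoof.
Variables (A B : pzRingType) (f : {rmorphism A -> B}) (s : B -> A) (v w : A).
Hypothesis sK : cancel s f.
Hypothesis corner_ker : forall x, f x = 0 -> w * x * w = 0.
Hypotheses (fv : f v = 1) (fw : f w = 1) (ww : w * w = w) (wv : w * v = w).
Hypothesis vxv : forall x, v * x * v = v * x.
Hypothesis vxw : forall x, v * x * w = w * x * w.

Lemma corner_fiber x y : f x = f y -> w * x * w = w * y * w.
Proof.
move=> fxy; apply/eqP; rewrite -subr_eq0 -mulrBl -mulrBr; apply/eqP.
by apply: corner_ker; rewrite rmorphB fxy subrr.
Qed.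

Lemma left_mul_nonunitalM : {morph (fun x => v * x) : x y / x * y}.
Proof. by move=> x y; rewrite /= !mulrA vxv. Qed.

Definition left_mul_morphism : nonunital_morphism A A :=
  NonunitalMorphism (mulrDr v) left_mul_nonunitalM.

(** The inverse of the isomorphism from w A w onto B induced by f. The section s is only a map of
    sets; [corner_fiber] makes the choice immaterial. *)
Definition corner_lift (b : B) : A := w * s b * w.

Lemma corner_liftE a : corner_lift (f a) = w * a * w.
Proof. by apply: corner_fiber; rewrite sK. Qed.

Lemma corner_liftD : {morph corner_lift : x y / x + y}.
Proof.
move=> x y; rewrite -[x]sK -[y]sK -rmorphD !corner_liftE.
by rewrite mulrDr mulrDl.
Qed.

Lemma corner_liftM : {morph corner_lift : x y / x * y}.
Proof.
move=> x y; rewrite -[x]sK -[y]sK -rmorphM !corner_liftE.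
move: (s x) (s y) => {}x {}y.
(* As w = w v, a factor v can be inserted between x and y; then v y w = w y w turns it into w. *)
transitivity (w * (v * x * v) * y * w); first by rewrite vxv !mulrA wv.
transitivity (w * x * (v * y * w)); first by rewrite !mulrA wv.
by rewrite vxw !mulrA -[w * x * w * w]mulrA ww.
Qed.

Definition corner_lift_morphism : nonunital_morphism B A :=
  NonunitalMorphism corner_liftD corner_liftM.

Lemma corner_lift1 : corner_lift 1 = w.
Proof. by rewrite -(rmorph1 f) corner_liftE mulr1 ww. Qed.

Local Notation hT := left_mul_morphism.
Local Notation hF := corner_lift_morphism.
Local Notation restr_mod M := (Defs_restr__canonical__GRing_Lmodule f M).

Section OverA.
Variable M : lmodType A^c.

Definition roof_incl (m : corner hT M) : M := val m.
Lemma roof_incl_linear : linear roof_incl.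
Proof.
move=> a m n; rewrite /roof_incl raddfD /= -[val m in RHS]corner1 scalerA.
by rewrite -[X in _ = X *: _ + _]/(v * 1 * a : A) mulr1.
Qed.
HB.instance Definition _ :=
  GRing.isLinear.Build A^c (corner hT M) M _ roof_incl roof_incl_linear.

Definition roof_proj (m : corner hT M) : restr_mod (corner hF M) :=
  to_corner hF (val m).
(** Linearity amounts to v a w = w (w a w): acting by a on M v and then cutting by w agrees with
    cutting first and acting through f a. *)
Lemma roof_proj_linear : linear roof_proj.
Proof.
move=> a m n; apply: val_inj; rewrite /= scalerDr !scalerA; congr (_ *: _ + _).
rewrite -[LHS]/(v * a * corner_lift 1) -[RHS]/(corner_lift 1 * corner_lift (f a)).
by rewrite corner_lift1 corner_liftE vxw !mulrA ww.
Qed.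
HB.instance Definition _ :=
  GRing.isLinear.Build A^c (corner hT M) (restr_mod (corner hF M)) _
    roof_proj roof_proj_linear.
End OverA.

Section OverB.
Variable N : lmodType B^c.

Definition corner_restr (m : corner hF (restr_mod N)) : N := val m.
Lemma corner_restr_linear : linear corner_restr.
Proof.
move=> b m n; rewrite /corner_restr raddfD /=; congr (_ + _).
rewrite -[LHS]/((f (corner_lift b) : B^c) *: (val m : N)).
by rewrite /corner_lift !rmorphM fw sK mulr1 mul1r.
Qed.
HB.instance Definition _ :=
  GRing.isLinear.Build B^c (corner hF (restr_mod N)) N _
    corner_restr corner_restr_linear.

Definition restr_corner (n : N) : corner hF (restr_mod N) :=
  @to_corner _ _ hF (restr_mod N) n.

(** On a restricted module w acts as f w = 1, so cutting by w changes nothing; [roof_sectionK] is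
    the same for v. *)
Lemma val_restr_corner n : val (restr_corner n) = n.
Proof.
rewrite -[LHS]/((f (corner_lift 1) : B^c) *: n) corner_lift1 fw.
exact: (@scale1r B^c N n).
Qed.

Lemma restr_cornerK : cancel restr_corner corner_restr.
Proof. exact: val_restr_corner. Qed.
Lemma corner_restrK : cancel corner_restr restr_corner.
Proof. by move=> m; apply: val_inj; rewrite val_restr_corner. Qed.

Lemma restr_corner_linear : linear restr_corner.
Proof.
move=> b m n; apply: (can_inj corner_restrK).
by rewrite corner_restr_linear !restr_cornerK.
Qed.
HB.instance Definition _ :=
  GRing.isLinear.Build B^c N (corner hF (restr_mod N)) _
    restr_corner restr_corner_linear.

Definition roof_section (n : restr_mod N) : corner hT (restr_mod N) :=
  @to_corner _ _ hT (restr_mod N) n.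
Lemma roof_sectionK : cancel roof_section (@roof_incl (restr_mod N)).
Proof.
move=> n; rewrite -[LHS]/((f (v * 1) : B^c) *: (n : N)) mulr1 fv.
exact: (@scale1r B^c N n).
Qed.
Lemma roof_section_linear : linear roof_section.
Proof.
move=> a m n; apply: val_inj.
by rewrite -![val _]/(roof_incl _) roof_incl_linear !roof_sectionK.
Qed.
HB.instance Definition _ :=
  GRing.isLinear.Build A^c (restr_mod N) (corner hT (restr_mod N)) _
    roof_section roof_section_linear.
End OverB.

Local Notation DA := (derived_category A).
Local Notation DB := (derived_category B).
Local Notation T := (corner_derived hT).
Local Notation F := (corner_derived hF).
Local Notation R := (restr_derived f).

Definition roof_incl_cm (X : complexes A) : hom (corner_complexes hT X) X :=
  @ChainMap A (corner_complex hT X) X (fun n => @roof_incl (term X n))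
    (fun n x => erefl).

Lemma roof_proj_cm_diff (X : complex A) n (x : corner hT (term X n)) :
  roof_proj (corner_map (diff X n) x) =
  restr_map (corner_map (diff X n)) (roof_proj x).
Proof. by apply: val_inj; rewrite /= linearZ_LR. Qed.

Definition roof_proj_cm (X : complexes A) :
    hom (corner_complexes hT X)
        (restr_complexes f (corner_complexes hF X)) :=
  @ChainMap A (corner_complex hT X) (restr_complex f (corner_complex hF X))
    (fun n => @roof_proj (term X n)) (@roof_proj_cm_diff X).

Definition corner_restr_cm (X : complexes B) :
    hom (corner_complexes hF (restr_complexes f X)) X :=
  @ChainMap B (corner_complex hF (restr_complex f X)) X
    (fun n => @corner_restr (term X n)) (fun n x => erefl).

Lemma restr_corner_cm_diff (X : complex B) n (x : term X n) :
  restr_corner (diff X n x) =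
  corner_map (diff (restr_complex f X) n) (restr_corner x).
Proof.
apply: val_inj; rewrite [LHS]val_restr_corner /=.
by rewrite [X in restr_map _ X]val_restr_corner.
Qed.

Definition restr_corner_cm (X : complexes B) :
    hom X (corner_complexes hF (restr_complexes f X)) :=
  @ChainMap B X (corner_complex hF (restr_complex f X))
    (fun n => @restr_corner (term X n)) (@restr_corner_cm_diff X).

Lemma roof_section_cm_diff (X : complex B) n (x : term X n) :
  roof_section (diff X n x) =
  corner_map (diff (restr_complex f X) n) (roof_section x).
Proof.
apply: val_inj; rewrite [LHS]roof_sectionK /=.
by rewrite [X in restr_map _ X]roof_sectionK.
Qed.

Definition roof_section_cm (X : complexes B) :
    hom (restr_complexes f X) (corner_complexes hT (restr_complexes f X)) :=
  @ChainMap A (restr_complex f X) (corner_complex hT (restr_complex f X))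
    (fun n => @roof_section (term X n)) (@roof_section_cm_diff X).

(** All the identities of the criterion already hold between chain maps, so each is checked
    elementwise and carried to the localization. *)
Lemma restr_derived_fully_faithful : fully_faithful R.
Proof.
apply: (@fully_faithful_of_roof DB DA R F T
  (fun X => loc_of (@quasi_iso B) (corner_restr_cm X))
  (fun X => loc_of (@quasi_iso B) (restr_corner_cm X))
  (fun Y => loc_of (@quasi_iso A) (roof_incl_cm Y))
  (fun X => loc_of (@quasi_iso A) (roof_section_cm X))
  (fun Y => loc_of (@quasi_iso A) (roof_proj_cm Y))).
- by apply: natural_localization => X Y g; apply: loc_square => n x.
- by apply: natural_localization => X Y g; apply: loc_square => n x.
- apply: natural_localization => X Y g; apply: loc_square => n x.
  by apply: val_inj; rewrite /= linearZ_LR.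
- by move=> X; apply: loc_section => n x; apply: restr_cornerK.
- by move=> X; apply: loc_section => n x; apply: roof_sectionK.
- move=> X; apply: loc_trans (loc_ofM _ _ _).
  by apply: loc_of_eq => n x.
Qed.

End IdempotentRoof.

(** * Sums of vertices as idempotents of the path algebra and its quotients *)

Section VertexIdempotents.
Variables (K : fieldType) (Q : quiver).
Implicit Types (S T : {set vertex Q}) (p : qpath Q) (x y : path_algebra K Q).

Definition vertex_sum S : path_algebra K Q :=
  \sum_(v in S) path_elt (trivial_path v).

Lemma vertex_sumT : vertex_sum setT = 1.
Proof. by apply: eq_bigl => v; rewrite inE. Qed.

Lemma vertex_sumC S : vertex_sum S + vertex_sum (~: S) = 1.
Proof.
rewrite -vertex_sumT [RHS](bigID (mem S)) /=; congr (_ + _).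
  by apply: eq_bigl => v; rewrite !inE.
by apply: eq_bigl => v; rewrite !inE.
Qed.

Lemma vertex_sum_mull S p :
  vertex_sum S * path_elt p = (path_source p \in S)%:R *: path_elt p.
Proof.
have pv v : path_elt (trivial_path v) * path_elt p =
    if v == path_source p then path_elt p else 0 :> path_algebra K Q.
  by rewrite [LHS]pa_mulE /path_mul path_cat1p eq_sym; case: eqP.
rewrite /vertex_sum mulr_suml (eq_bigr _ (fun v _ => pv v)).
rewrite -big_mkcondr /= big_andbC big_mkcondr big_pred1_eq.
by case: ifP; rewrite ?scale1r ?scale0r.
Qed.

Lemma vertex_sum_mulr S p :
  path_elt p * vertex_sum S = (path_target p \in S)%:R *: path_elt p.
Proof.
have pv v : path_elt p * path_elt (trivial_path v) =
    if v == path_target p then path_elt p else 0 :> path_algebra K Q.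
  by rewrite [LHS]pa_mulE /path_mul path_catp1 eq_sym; case: eqP.
rewrite /vertex_sum mulr_sumr (eq_bigr _ (fun v _ => pv v)).
rewrite -big_mkcondr /= big_andbC big_mkcondr big_pred1_eq.
by case: ifP; rewrite ?scale1r ?scale0r.
Qed.

Lemma path_algebra_scalerAl (a : K) x y : a *: x * y = a *: (x * y).
Proof. exact: pa_mulZl. Qed.

Lemma path_algebra_scalerAr (a : K) x y : x * (a *: y) = a *: (x * y).
Proof. exact: pa_mulZr. Qed.

(** Multiplying by the sums of S and T on the two sides keeps exactly the paths from S to T, so
    identities between such products are statements about endpoints of paths. *)
Lemma vertex_sum_sandwich S T S' T' :
  (forall p, (path_source p \in S) && (path_target p \in T) =
             (path_source p \in S') && (path_target p \in T')) ->
  forall x, vertex_sum S * x * vertex_sum T = vertex_sum S' * x * vertex_sum T'.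
Proof.
move=> ST; apply: pa_ext => [? ?|a x|? ?|a x|p].
- by rewrite mulrDr mulrDl.
- by rewrite path_algebra_scalerAr path_algebra_scalerAl.
- by rewrite mulrDr mulrDl.
- by rewrite path_algebra_scalerAr path_algebra_scalerAl.
have sandwichE U V : vertex_sum U * path_elt p * vertex_sum V =
    ((path_source p \in U) && (path_target p \in V))%:R *: path_elt p.
  rewrite vertex_sum_mull path_algebra_scalerAl vertex_sum_mulr scalerA.
  by rewrite -natrM mulnb.
by rewrite !sandwichE ST.
Qed.

Lemma vertex_sum_sub S T : S \subset T ->
  vertex_sum S * vertex_sum T = vertex_sum S.
Proof.
move=> /subsetP ST; rewrite /vertex_sum mulr_suml.
apply: eq_bigr => v /ST vT.
by rewrite vertex_sum_mulr [path_target _ \in T]vT scale1r.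
Qed.

Variable I : ideal (path_algebra K Q).

Definition vertex_idem S : quot_ring I := quot_proj I (vertex_sum S).

Lemma vertex_idemT : vertex_idem setT = 1.
Proof. by rewrite /vertex_idem vertex_sumT rmorph1. Qed.

Lemma vertex_idem_sub S T : S \subset T ->
  vertex_idem S * vertex_idem T = vertex_idem S.
Proof. by move=> ST; rewrite -rmorphM vertex_sum_sub. Qed.

Lemma vertex_idem_sandwich S T S' T' :
  (forall p, (path_source p \in S) && (path_target p \in T) =
             (path_source p \in S') && (path_target p \in T')) ->
  forall a, vertex_idem S * a * vertex_idem T =
            vertex_idem S' * a * vertex_idem T'.
Proof.
move=> ST a.
have := congr1 (quot_proj I) (vertex_sum_sandwich ST (quot_repr a)).
by rewrite !rmorphM /= quot_reprK.
Qed.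

Lemma vertex_idem_co (L : subquiver Q) :
  vertex_idem (sub_vertex L) + co_idempotent I L = 1.
Proof.
rewrite -[RHS](rmorph1 (quot_proj I)) -(vertex_sumC (sub_vertex L)) rmorphD.
by congr (_ + _); rewrite [RHS]rmorph_sum; apply: eq_bigl => v; rewrite inE.
Qed.

End VertexIdempotents.

(** * Reachable vertices and convexity *)

Definition reachable (Q : quiver) (S : {set vertex Q}) : {set vertex Q} :=
  [set v | `[< exists2 p : qpath Q, path_source p \in S & path_target p = v >]].

Lemma sub_reachable (Q : quiver) (S : {set vertex Q}) : S \subset reachable S.
Proof.
by apply/subsetP => v vS; rewrite inE; apply/asboolP; exists (trivial_path v).
Qed.

(** The junction vertex is recorded because convexity will be applied to it. *)
Lemma path_concat (Q : quiver) (p q : qpath Q) :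
  path_target p = path_source q ->
  exists r : qpath Q, [/\ path_source r = path_source p,
    path_target r = path_target q & path_source q \in path_vertices r].
Proof.
move=> pq; have [r _ vr] := path_catP pq; exists r.
have sr : path_source r = path_source p by rewrite /path_source vr.
have ar : path_arrows r = path_arrows p ++ path_arrows q.
  by rewrite /path_arrows vr.
split=> //.
  rewrite /path_target sr ar map_cat last_cat.
  by rewrite -[last (path_source p) _]/(path_target p) pq.
rewrite /path_vertices sr ar map_cat -cat_cons mem_cat -pq.
by rewrite /path_target mem_last.
Qed.

Lemma reachable_target (Q : quiver) (S : {set vertex Q}) (p : qpath Q) :
  path_source p \in reachable S -> path_target p \in reachable S.
Proof.
rewrite !inE => /asboolP[q qS qp]; apply/asboolP.
by have [r [rq rp _]] := path_concat qp; exists r; rewrite ?rq.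
Qed.

(** Prolonging p backwards by a path from L to its source gives a path with both ends in L that
    passes through that source. *)
Lemma convex_reachable (Q : quiver) (L : subquiver Q) (p : qpath Q) :
  convex L -> path_source p \in reachable (sub_vertex L) ->
  path_target p \in sub_vertex L -> path_source p \in sub_vertex L.
Proof.
move=> [_ convL]; rewrite inE => /asboolP[q qL qp] pL.
have [r [rq rp pr]] := path_concat qp.
by apply: (convL r) => //; rewrite ?rq ?rp.
Qed.

(* The ideal generated by 1 - w dies in the corner w R w as soon as cutting    *)
(* a product by w at both ends may also cut it in the middle.                  *)
Lemma gen_ideal_corner (R : pzRingType) (e w : R) :
  w + e = 1 -> (forall x y, w * x * y * w = w * x * w * y * w) ->
  forall x, gen_ideal (fun y => y = e) x -> w * x * w = 0.
Proof.
move=> we wP x Jx.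
(* Quantifying over a and b makes this a two-sided ideal; once it contains e, it contains the ideal
   generated by e. *)
pose J (y : R) := forall a b, w * a * y * b * w = 0.
suff: J x by move=> /(_ 1 1); rewrite !mulr1.
have J0 : J 0 by move=> a b; rewrite mulr0 !mul0r.
have JD y z : J y -> J z -> J (y + z).
  by move=> Jy Jz a b; rewrite mulrDr !mulrDl Jy Jz addr0.
have JMl c y : J y -> J (c * y).
  by move=> Jy a b; have := Jy (a * c) b; rewrite !mulrA.
have JMr c y : J y -> J (y * c).
  by move=> Jy a b; have := Jy a (c * b); rewrite !mulrA.
apply: (Jx (Ideal J0 JD JMl JMr)) => _ -> a b /=.
have -> : e = 1 - w by rewrite -we addrC addKr.
by rewrite mulrBr mulr1 !mulrBl wP subrr.
Qed.

Theorem theorem4p2 (K : fieldType) (Q : quiver) (I : ideal (path_algebra K Q))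
    (I_sub : forall x, I x -> gen_ideal (@paths_of_length K Q 2) x)
    (L : subquiver Q) (L_convex : convex L) :
  homological_epimorphism (quot_proj (co_ideal I L)).
Proof.
set f := quot_proj (co_ideal I L); pose lift := @quot_repr _ (co_ideal I L).
have fK : cancel lift f by apply: quot_reprK.
(* The projection is onto, hence an epimorphism. *)
split=> [C g h gh x|]; first by rewrite -[x]fK; apply: gh.
pose v := vertex_idem I (reachable (sub_vertex L)).
pose w := vertex_idem I (sub_vertex L).
have vxv x : v * x * v = v * x.
  rewrite -[RHS]mulr1 -vertex_idemT; apply: vertex_idem_sandwich => p.
  by rewrite in_setT andbT; apply/andb_idr/reachable_target.
have vxw x : v * x * w = w * x * w.
  apply: vertex_idem_sandwich => p.
  apply: andb_id2r => pL; apply/idP/idP => [/convex_reachable->//|].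
  exact/subsetP/sub_reachable.
have ww : w * w = w by rewrite vertex_idem_sub.
have wv : w * v = w by rewrite vertex_idem_sub ?sub_reachable.
have we : w + co_idempotent I L = 1 := vertex_idem_co I L.
have fw : f w = 1.
  (* The difference w - 1 is -e'_L, a multiple of the generator. *)
  rewrite -(rmorph1 f); apply/quot_projP; rewrite -we opprD addNKr -mulN1r.
  by apply: idealMl => J; apply.
apply: (restr_derived_fully_faithful fK (v := v) (w := w)) => // [x fx0|].
  apply: (gen_ideal_corner we) => [y z|].
    transitivity (w * (v * y * v) * z * w); first by rewrite vxv !mulrA wv.
    transitivity (w * y * (v * z * w)); first by rewrite !mulrA wv.
    by rewrite vxw !mulrA.
  by rewrite -[x]subr0; apply/quot_projP; rewrite rmorph0.
(* f v = f w * f v = f (w v) = f w = 1. *)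
by rewrite -[LHS]mul1r -fw -rmorphM wv.
Qed.
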